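(* Let $\varphi$ be a quantifier-free conjunction of equality literals, let $G=\langle N,E,L,\mathit{root}\rangle=\mathit{egraph}(\varphi)$ be its egraph, and let $r:N\to N$ be a representative function for $G$. Then the procedure $G.\mathit{toformula}(r,\emptyset)$ terminates and returns a formula $\psi$ such that $\psi^\exists\equiv\varphi^\exists$ if and only if $r$ is admissible for $G$.
   Context: Work in multi-sorted first-order logic whose signature has only function symbols and constants; predicates are $\mathsf{Bool}$-valued functions, and a literal $P(a)$ (resp. $\neg P(a)$) abbreviates $P(a)\approx\top$ (resp. $P(a)\approx\bot$). For a formula $\chi$, $\chi^\exists$ denotes its existential closure. Entailment $\models$ and equivalence $\equiv$ are those of the theory of equality with uninterpreted functions. An egraph is a tuple $G=\langle N,E,L,\mathit{root}\rangle$ where $\langle N,E\rangle$ is a finite directed acyclic graph with ordered successors ($n[i]$ denotes the $i$-th child of $n$, $\deg(n)$ its out-degree, and a leaf is a node of out-degree 0), $L$ maps each node to a function symbol or a logical variable, and $\mathit{root}:N\to N$ is such that $\rho_{\mathit{root}}=\{(n,n')\mid \mathit{root}(n)=\mathit{root}(n')\}$ is an equivalence relation closed under congruence: $(n,n')\in\rho_{\mathit{root}}$ whenever $L(n)=L(n')$, $\deg(n)=\deg(n')>0$ and $(n[i],n'[i])\in\rho_{\mathit{root}}$ for all $i$. The class of $n$ is $\mathit{class}(n)=\rho_{\mathit{root}}(n)$. The term of $n$ is $\mathit{ntt}(n)=f$ if $\deg(n)=0$ and $f(\mathit{ntt}(n[1]),\dots,\mathit{ntt}(n[\deg(n)]))$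 otherwise, where $f=L(n)$; distinct nodes have distinct terms. For a conjunction of equalities $\varphi=(t_1\approx u_1\wedge\dots\wedge t_k\approx u_k)$, $\mathit{egraph}(\varphi)$ is the egraph with one node for each subterm of the $t_i,u_i$ and with $\rho_{\mathit{root}}$ the congruence closure of the equalities $t_i\approx u_i$. A representative function for $G$ is a function $r:N\to N$ (choosing representative nodes). The recursive procedure $\mathit{toexpr}(n,r)$ returns $L(n)$ if $\deg(n)=0$, and otherwise returns $L(n)(\mathit{toexpr}(r(n[1]),r),\dots,\mathit{toexpr}(r(n[\deg(n)]),r))$ (this may fail to terminate). For $S\subseteq N$, the procedure $\mathit{toformula}(r,S)$ initializes a set of literals $\mathit{Lits}=\emptyset$; for every node $m$ with $r(m)=m$ it computes $t=\mathit{toexpr}(m,r)$ and, for every $n\in\mathit{class}(m)\setminus\{m\}$ with $n\notin S$, adds the literal $t\approx\mathit{toexpr}(n,r)$ to $\mathit{Lits}$; it returns $\bigwedge\mathit{Lits}$. $r$ is admissible for $G$ if (a) $r$ assigns a unique representative to each class, i.e. $r(n)\in\mathit{class}(n)$ and $r$ is constant on each class; (b) $\rho_{\mathit{root}}=\rho_r$ where $\rho_r=\{(n,n')\mid r(n)=r(n')\}$; and (c) the graph $G_r=\langle N,E_r\rangle$ with $E_r=\{(n,r(c))\mid n\in N,\ c \text{ a child of } n\}$ is acyclic.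
   Formalization: ''Representative function'' is taken to mean that r(n) lies in class(n) and r is constant on each class (clause (a) of admissibility); for arbitrary r the ''only if'' part fails, e.g. φ = (a≈b) with r the identity. *)

(* Defs.v *)
From HB Require Import structures.
From Stdlib Require Import RelationClasses.
From mathcomp Require Import all_boot.

Set Implicit Arguments.
Unset Strict Implicit.
Unset Printing Implicit Defensive.

(** * Multi-sorted first-order logic over function symbols only *)

(* Sorts are [option usort], where [None] is the sort Bool.  Function symbols
   are [bool + ufun], where [inl true] and [inl false] are the constants top and
   bottom of sort Bool.  Predicates are the symbols whose codomain is Bool. *)
Record signature := Signature {
  usort : eqType;
  ufun : eqType;
  udom : ufun -> seq (option usort);
  ucod : ufun -> option usort }.

Definition sorts (Sg : signature) : eqType := option (usort Sg).

Definition fsym (Sg : signature) : eqType := (bool + ufun Sg)%type.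

(* Every sort has countably many variables. *)
Definition var (Sg : signature) : eqType := (nat * sorts Sg)%type.

Definition head_symbol (Sg : signature) : eqType := (fsym Sg + var Sg)%type.

Definition dom Sg (f : fsym Sg) : seq (sorts Sg) :=
  if f is inr g then udom g else [::].
Definition cod Sg (f : fsym Sg) : sorts Sg :=
  if f is inr g then ucod g else None.

(* Raw terms; the leaf [App l [::]] is a constant or a variable.  Arities and
   sorts, including the absence of arguments below a variable, are imposed by
   [well_sorted]. *)
Inductive term (Sg : signature) : Type :=
  App of head_symbol Sg & seq (term Sg).

Section TermEq.
Variable Sg : signature.

Fixpoint term_encode (t : term Sg) : GenTree.tree (head_symbol Sg) :=
  let: App l ts := t in GenTree.Node 0 (GenTree.Leaf l :: map term_encode ts).

Fixpoint term_decode (g : GenTree.tree (head_symbol Sg)) : option (term Sg) :=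
  if g is GenTree.Node _ (GenTree.Leaf l :: gs)
  then Some (App l (pmap term_decode gs)) else None.

Lemma term_encodeK : pcancel term_encode term_decode.
Proof.
rewrite /pcancel; fix IH 1 => -[l ts] /=; congr (Some (App l _)).
by elim: ts => //= t ts ->; rewrite IH.
Qed.

HB.instance Definition _ := Equality.copy (term Sg) (pcan_type term_encodeK).
End TermEq.

Definition head_sort Sg (l : head_symbol Sg) : sorts Sg :=
  match l with inl f => cod f | inr x => x.2 end.

Definition term_sort Sg (t : term Sg) : sorts Sg :=
  let: App l _ := t in head_sort l.

Fixpoint well_sorted Sg (t : term Sg) : bool :=
  let: App l ts := t in
  all (@well_sorted Sg) ts &&
  match l with
  | inl f => map (@term_sort Sg) ts == dom f
  | inr _ => nilp ts
  end.

Fixpoint subterms Sg (t : term Sg) : seq (term Sg) :=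
  let: App _ ts := t in t :: flatten (map (@subterms Sg) ts).

Fixpoint term_vars Sg (t : term Sg) : seq (var Sg) :=
  let: App l ts := t in
  (if l is inr x then [:: x] else [::]) ++ flatten (map (@term_vars Sg) ts).

(* The pair [(t, u)] stands for the literal t = u. *)
Definition equation (Sg : signature) : eqType := (term Sg * term Sg)%type.

Definition well_sorted_eqn Sg (e : equation Sg) : bool :=
  [&& well_sorted e.1, well_sorted e.2 & term_sort e.1 == term_sort e.2].

Inductive formula (Sg : signature) : Type :=
  | FTrue
  | FEq of term Sg & term Sg
  | FAnd of formula Sg & formula Sg
  | FEx of var Sg & formula Sg.
Arguments FTrue {Sg}.

Definition conjunction Sg (es : seq (equation Sg)) : formula Sg :=
  foldr (fun e F => FAnd (FEq e.1 e.2) F) FTrue es.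

Fixpoint free_vars Sg (F : formula Sg) : seq (var Sg) :=
  match F with
  | FTrue => [::]
  | FEq t u => term_vars t ++ term_vars u
  | FAnd F1 F2 => free_vars F1 ++ free_vars F2
  | FEx x F1 => [seq y <- free_vars F1 | y != x]
  end.

Definition ex_closure Sg (F : formula Sg) : formula Sg :=
  foldr (@FEx Sg) F (undup (free_vars F)).

(** ** Semantics: EUF *)

Definition carrier_of Sg (D : usort Sg -> Type) (s : sorts Sg) : Type :=
  if s is Some u then D u else bool.

(* Carriers are nonempty, as witnessed by [point]; Bool is two-valued. *)
Record structure (Sg : signature) := Structure {
  ucarrier : usort Sg -> Type;
  point : forall u, ucarrier u;
  interp : forall g : ufun Sg,
    (forall i : 'I_(size (udom g)),
       carrier_of ucarrier (tnth (in_tuple (udom g)) i)) ->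
    carrier_of ucarrier (ucod g) }.

Section Semantics.
Variables (Sg : signature) (M : structure Sg).

Definition carrier : sorts Sg -> Type := carrier_of (@ucarrier Sg M).

Definition default (s : sorts Sg) : carrier s :=
  if s is Some u then point M u else true.

Definition valuation : Type := forall x : var Sg, carrier x.2.

(* The value of a raw term is tagged with its sort.  When the i-th argument is
   missing or has the wrong sort, [nth_arg] falls back on [default]; this never
   happens inside a well-sorted term. *)
Definition nth_arg (s : sorts Sg) (vs : seq {s & carrier s}) (i : nat) :
    carrier s :=
  let d := Tagged carrier (default s) in tagged_as d (nth d vs i).

Definition apply (f : fsym Sg) (vs : seq {s & carrier s}) : carrier (cod f) :=
  match f return carrier (cod f) with
  | inl b => b
  | inr g => @interp Sg M g (fun i => nth_arg (tnth (in_tuple (udom g)) i) vs i)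
  end.

Fixpoint eval (v : valuation) (t : term Sg) : {s & carrier s} :=
  let: App l ts := t in
  match l with
  | inl f => Tagged carrier (apply f (map (eval v) ts))
  | inr x => Tagged carrier (v x)
  end.

Fixpoint sat (v : valuation) (F : formula Sg) : Prop :=
  match F with
  | FTrue => True
  | FEq t u => eval v t = eval v u
  | FAnd F1 F2 => sat v F1 /\ sat v F2
  | FEx x F1 => exists d : carrier x.2, sat (dfwith v d) F1
  end.
End Semantics.

Definition equivalent Sg (F1 F2 : formula Sg) : Prop :=
  forall (M : structure Sg) (v : valuation M), sat v F1 <-> sat v F2.

(** * Egraphs *)

(* [cycle e [::]] holds by convention; [cycle e [:: x]] is a self-loop. *)
Definition acyclic (T : eqType) (e : rel T) : Prop :=
  forall p : seq T, cycle e p -> p = [::].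

Section Graph.
Variables (Sg : signature) (N : finType).
Variables (L : N -> head_symbol Sg) (succ : N -> seq N).

Definition edge : rel N := fun n c => c \in succ n.

(* Children are numbered from 0; the value is junk for [deg n <= i]. *)
Definition deg (n : N) : nat := size (succ n).
Definition child (n : N) (i : nat) : N := nth n (succ n) i.

Definition congruence_closed (R : N -> N -> Prop) : Prop :=
  forall n m, L n = L m -> deg n = deg m -> 0 < deg n ->
    (forall i, i < deg n -> R (child n i) (child m i)) -> R n m.

(* The recursion is cut at depth [#|N|], which no path of an acyclic graph
   exceeds; see [nttE]. *)
Fixpoint ntt_rec (k : nat) (n : N) : term Sg :=
  App (L n) (if k is k'.+1 then map (ntt_rec k') (succ n) else [::]).
Definition ntt : N -> term Sg := ntt_rec #|N|.

Lemma acyclic_uniq n p : acyclic edge -> path edge n p -> uniq (n :: p).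
Proof.
move=> acy; elim: p n => [|m p IH] n //= /andP[nm mp].
have /= -> := IH m mp; rewrite andbT; apply/negP => n_in.
have: path edge n (m :: p) by rewrite /= nm.
case/path.splitP: n_in => p1 p2; rewrite cat_path => /andP[cyc _].
by have := acy (n :: p1) cyc.
Qed.

Lemma nttE : acyclic edge -> forall n, ntt n = App (L n) (map ntt (succ n)).
Proof.
move=> acy n; suff stable k m : (forall p, path edge m p -> size p <= k) ->
    ntt_rec k.+1 m = ntt_rec k m.
  rewrite -[RHS]/(ntt_rec #|N|.+1 n) stable // => p np.
  have := acyclic_uniq acy np; move/card_uniqP => sz.
  by have := max_card (mem (n :: p)); rewrite sz => /ltnW.
elim: k m => [|k IH] m bound.
  rewrite /=; case E: (succ m) => [//|c cs]; have := bound [:: c].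
  by rewrite /= /edge E mem_head; move/(_ isT).
congr App; apply/eq_in_map => c mc; apply: IH => p cp.
by apply: (bound (c :: p)); rewrite /= cp /edge mc.
Qed.
End Graph.

(* The root of a class is not required to be a particular node, nor to belong
   to the class: only the kernel of [root] matters. *)
Record egraph (Sg : signature) := Egraph {
  node : finType;
  label : node -> head_symbol Sg;
  succ : node -> seq node;
  root : node -> node;
  succ_acyclic : acyclic (edge succ);
  root_congruence : congruence_closed label succ (fun n m => root n = root m);
  ntt_injective : injective (ntt label succ) }.

Definition node_term Sg (G : egraph Sg) : node G -> term Sg :=
  ntt (@label _ G) (@succ _ G).

Definition same_class Sg (G : egraph Sg) : rel (node G) :=
  fun n m => root n == root m.

Section EgraphOf.
Variables (Sg : signature) (phi : seq (equation Sg)) (G : egraph Sg).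

Definition congruence_closure (n m : node G) : Prop :=
  forall R : node G -> node G -> Prop, Equivalence R ->
    (forall n' m', (node_term n', node_term m') \in phi -> R n' m') ->
    congruence_closed (@label _ G) (@succ _ G) R ->
    R n m.

(* [G] is egraph(phi), which is determined up to renaming of the nodes and up
   to the choice of a map [root] with the prescribed kernel. *)
Definition is_egraph_of : Prop :=
  (forall t : term Sg,
     (exists n : node G, node_term n = t) <->
     (exists2 e, e \in phi & t \in subterms e.1 ++ subterms e.2)) /\
  (forall n m : node G, root n = root m <-> congruence_closure n m).
End EgraphOf.

(** * Extraction of a formula *)

(* All the values, provided that all of them are defined. *)
Fixpoint oseq (T : Type) (s : seq (option T)) : option (seq T) :=
  if s is o :: s' then obind (fun x => omap (cons x) (oseq s')) o
  else Some [::].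

Section ToFormula.
Variables (Sg : signature) (G : egraph Sg) (r : node G -> node G).

(* The procedures are run with a bound [k] on the recursion depth of [toexpr];
   [None] means that the bound was hit. *)
Fixpoint toexpr (k : nat) (n : node G) : option (term Sg) :=
  if k is k'.+1 then
    omap (App (label n)) (oseq [seq toexpr k' (r c) | c <- succ n])
  else None.

Definition class_lits (k : nat) (S : {set node G}) (m : node G) :
    option (seq (equation Sg)) :=
  obind (fun t =>
      omap (map (pair t))
        (oseq [seq toexpr k n
              | n <- enum [pred n | [&& same_class m n, n != m & n \notin S]]]))
    (toexpr k m).

Definition toformula_lits (k : nat) (S : {set node G}) :
    option (seq (equation Sg)) :=
  omap (fun ls => undup (flatten ls))
    (oseq [seq class_lits k S m | m <- enum [pred m | r m == m]]).

Definition toformula_returns (S : {set node G}) (psi : formula Sg) : Prop :=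
  exists k, omap (@conjunction Sg) (toformula_lits k S) = Some psi.

Definition unique_representatives : Prop :=
  (forall n, same_class n (r n)) /\
  (forall n m, same_class n m -> r n = r m).

Definition representative_edge : rel (node G) :=
  fun n m => m \in map r (succ n).

Definition admissible : Prop :=
  [/\ unique_representatives,
      forall n m, root n = root m <-> r n = r m
    & acyclic representative_edge].
End ToFormula.

(* Main.v *)
From Stdlib Require Import Setoid.
Require Import Defs.
From mathcomp Require Import all_boot.

Set Implicit Arguments.
Unset Strict Implicit.
Unset Printing Implicit Defensive.

(* If [toexpr] terminates on every node then [G_r] has no cycle, since a node on
   a cycle never gets a value; this settles one direction.  Conversely, when
   [G_r] is acyclic, [toexpr n] is the term of [n] in [G_r].  In a model of phi,
   induction along [G_r] shows that it has the value of the term of [n] in [G];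
   in a model of psi, induction along [G] shows the same.  In both cases the
   literals of phi and of psi say that nodes of the same class have the same
   value, so phi and psi have the same models, even before quantification. *)

Lemma oseq_Some (T : Type) (s : seq (option T)) (xs : seq T) :
  oseq s = Some xs <-> s = map some xs.
Proof.
split; last by move->; elim: xs => //= x xs ->.
elim: s xs => [|[x|] s IH] xs //=; first by case=> <-.
by case: (oseq s) IH => //= ys IH [<-]; rewrite (IH ys).
Qed.

Lemma oseq_map_Some (I : eqType) (T : Type) (f : I -> option T)
    (s : seq I) (xs : seq T) i :
  oseq (map f s) = Some xs -> i \in s -> f i <> None.
Proof.
move/oseq_Some; elim: s xs => [|j s IH] [|x xs] //= [fj fs].
by rewrite inE => /predU1P[->|/(IH _ fs)//]; rewrite fj.
Qed.

(** A path of an acyclic graph repeats no node, so it has fewer than [#|N|] edges; the induction is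
    on a strict bound for the paths leaving a node. *)
Lemma acyclic_ind (N : finType) (succ : N -> seq N) (P : N -> Prop) :
  acyclic (edge succ) ->
  (forall n, (forall c, c \in succ n -> P c) -> P n) -> forall n, P n.
Proof.
move=> acy step n; suff bounded k m :
    (forall p, path (edge succ) m p -> size p < k) -> P m.
  apply: (bounded #|N|) => p /(acyclic_uniq acy)/card_uniqP/= <-.
  exact: max_card.
elim: k m => [|k IH] m bound; first by have := bound [::] isT.
apply: step => c mc; apply: IH => p cp.
by apply: (bound (c :: p)); rewrite /= cp /edge mc.
Qed.

(** * Coincidence and existential closure *)

Section Coincidence.
Variables (Sg : signature) (M : structure Sg).
Implicit Types (v w : valuation M) (F : formula Sg).

Lemma eval_App v l ts us :
  map (eval v) ts = map (eval v) us -> eval v (App l ts) = eval v (App l us).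
Proof. by case: l => //= f ->. Qed.

Lemma eval_agree v w t : {in term_vars t, forall x, v x = w x} ->
  eval v t = eval w t.
Proof.
move: t; fix IH 1 => -[[f|x] ts] /= agree; last by rewrite agree ?mem_head.
suff -> : map (eval v) ts = map (eval w) ts by [].
elim: ts agree => //= t ts IHts agree.
by rewrite IH ?IHts // => x xt; apply: agree; rewrite mem_cat xt ?orbT.
Qed.

Lemma sat_agree v w F : {in free_vars F, forall x, v x = w x} ->
  sat v F -> sat w F.
Proof.
elim: F v w => [|t u|F1 IH1 F2 IH2|x F IH] v w //= agree.
- by rewrite !(@eval_agree v w) // => x xt; apply: agree;
    rewrite mem_cat xt ?orbT.
- by case=> /IH1 s1 /IH2 s2; split; [apply: s1|apply: s2] => x xF;
    apply: agree; rewrite mem_cat xF ?orbT.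
case=> d sF; exists d; apply: IH sF => y yF.
have [->|yx] := eqVneq y x; first by rewrite !dfwith_in.
by rewrite !dfwith_out 1?eq_sym //; apply: agree; rewrite mem_filter yx.
Qed.

Lemma sat_ex_closure v F : sat v (ex_closure F) <-> exists w, sat (M := M) w F.
Proof.
rewrite /ex_closure; split.
  by elim: (undup _) v => [|x xs IH] v /=; [exists v|case=> d /IH].
(* Invariant: [v] already agrees with [w] on the free variables that the remaining quantifiers do
   not reset. *)
case=> w sF; have: {in free_vars F, forall x, x \notin undup (free_vars F) ->
    v x = w x} by move=> x; rewrite mem_undup => ->.
elim: (undup _) v => [|x xs IH] v /= agree.
  by apply: sat_agree sF => x xF; rewrite agree.
exists (w x); apply: IH => y yF yxs.
have [->|yx] := eqVneq y x; first by rewrite dfwith_in.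
by rewrite dfwith_out 1?eq_sym //; apply: agree; rewrite // inE negb_or yx.
Qed.

Lemma sat_conjunction v es :
  sat v (conjunction es) <-> {in es, forall e, eval v e.1 = eval v e.2}.
Proof.
elim: es => //= e es [IH1 IH2]; split=> [[ve /IH1 ves] e'|ves].
  by rewrite inE => /predU1P[->|/ves].
split; first by rewrite ves ?mem_head.
by apply: IH2 => e' ees; apply: ves; rewrite inE ees orbT.
Qed.
End Coincidence.

(** * Termination of the extraction and the literals it yields *)

Section ToFormulaTheory.
Variables (Sg : signature) (G : egraph Sg) (r : node G -> node G).
Hypothesis hr : unique_representatives r.

Lemma node_termE n :
  node_term n = App (label n) (map (@node_term _ G) (succ n)).
Proof. exact: nttE (@succ_acyclic _ G) n. Qed.

Lemma repr_idem n : r (r n) = r n.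
Proof. by case: hr => cl eqr; rewrite -(eqr n (r n)). Qed.

Lemma same_class_repr n m : same_class n m = (r n == r m).
Proof.
case: hr => cl eqr; apply/idP/eqP => [/eqr//|rnm].
by apply/eqP; rewrite (eqP (cl n)) (eqP (cl m)) rnm.
Qed.

(** The call on a node of the cycle triggers a call on the next node of the cycle with less fuel, so
    the fuel always runs out. *)
Lemma toexpr_cycle k p n :
  cycle (representative_edge r) p -> n \in p -> toexpr r k n = None.
Proof.
move=> cyc; elim: k n => //= k IH n np.
case Es: (oseq _) => [ts|//]; have := next_cycle cyc np.
case/mapP=> c nc next_n; case: (oseq_map_Some Es nc).
by rewrite -next_n; apply: IH; rewrite mem_next.
Qed.

(** Since no node is excluded, treating the class of [r n] calls [toexpr] on [r n] and on all its
    other members, [n] among them. *)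
Lemma toformula_lits_toexpr k ls n :
  toformula_lits r k set0 = Some ls -> toexpr r k n <> None.
Proof.
rewrite /toformula_lits; case Es: (oseq _) => [lss|//] _.
have := oseq_map_Some (i := r n) Es.
rewrite mem_enum inE repr_idem eqxx => /(_ isT); rewrite /class_lits.
case Er: (toexpr r k (r n)) => [t|//] /=; case Ec: (oseq _) => [us|//] _.
have [->|nr] := eqVneq n (r n); first by rewrite Er.
apply: (oseq_map_Some Ec); rewrite mem_enum !inE nr andbT.
by rewrite same_class_repr repr_idem.
Qed.

(** The term of a node in $G_r$, obtained by reusing [ntt] so that [nttE] gives its recursion
    equation. *)
Definition expr : node G -> term Sg :=
  ntt (@label _ G) (fun n => map r (succ n)).

Hypothesis acy : acyclic (representative_edge r).

Lemma exprE n : expr n = App (label n) [seq expr (r c) | c <- succ n].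
Proof.
by rewrite {1}/expr (nttE _ acy) -map_comp.
Qed.

Lemma toexpr_expr n : toexpr r #|node G| n = Some (expr n).
Proof.
have bound p : path (representative_edge r) n p -> size p < #|node G|.
  move/(acyclic_uniq (succ := fun n => map r (succ n)) acy)/card_uniqP => /= <-.
  exact: max_card.
elim: #|_| n bound => [|k IH] n bound; first by have := bound [::] isT.
rewrite /= exprE; suff -> : [seq toexpr r k (r c) | c <- succ n] =
    map some [seq expr (r c) | c <- succ n].
  by rewrite (proj2 (oseq_Some _ _) erefl).
rewrite -map_comp; apply/eq_in_map => c nc; apply: IH => p cp.
by apply: (bound (r c :: p)); rewrite /= cp /representative_edge map_f.
Qed.

(** A representative [m] in the class of [n] must be [r n], so the literals are indexed by [n]
    alone. *)
Lemma toformula_litsE : exists2 ls,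
  toformula_lits r #|node G| set0 = Some ls &
  forall e, e \in ls <->
    exists n, [/\ n != r n & e = (expr (r n), expr n)].
Proof.
pose cl (m : node G) := enum [pred n | [&& same_class m n, n != m & n \notin set0]].
pose lits m := map (pair (expr m)) (map expr (cl m)).
exists (undup (flatten (map lits (enum [pred m | r m == m])))).
  rewrite /toformula_lits (proj2 (oseq_Some _ _)
    (_ : _ = map some (map lits (enum [pred m | r m == m])))) //.
  rewrite -map_comp; apply: eq_map => m; rewrite /class_lits toexpr_expr /=.
  rewrite (eq_map toexpr_expr) (map_comp some expr).
  by rewrite (proj2 (oseq_Some _ _) erefl).
move=> e; rewrite mem_undup; split=> [/flatten_mapP[m]|[n [nr ->]]].
  rewrite mem_enum inE => /eqP rm; rewrite /lits -map_comp => /mapP[n].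
  rewrite mem_enum !inE same_class_repr rm => /andP[/eqP-> /andP[nr _]] ->.
  by exists n.
apply/flatten_mapP; exists (r n); first by rewrite mem_enum inE repr_idem.
rewrite /lits -map_comp; apply/mapP; exists n => //.
by rewrite mem_enum !inE same_class_repr repr_idem eqxx nr.
Qed.
End ToFormulaTheory.

(** * Comparing the models of the equalities and of the literals *)

Section Models.
Variables (Sg : signature) (phi : seq (equation Sg)) (G : egraph Sg).
Hypothesis hG : is_egraph_of phi G.
Variables (M : structure Sg) (v : valuation M).

Lemma sat_egraph : sat v (conjunction phi) <->
  forall n m : node G, same_class n m ->
    eval v (node_term n) = eval v (node_term m).
Proof.
rewrite sat_conjunction; case: hG => terms classes; split=> [vphi n m|vG e e_phi].
  (* Having equal values under [v] is itself a congruence containing phi, so it contains the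
     congruence closure. *)
  move/eqP/classes/(_ (fun n m => eval v (node_term n) = eval v (node_term m))).
  apply=> [|n' m' /vphi //|n' m' Ll Ldeg _ ch].
    by split=> [x|x y|x y z] // -> ->.
  rewrite !node_termE Ll; apply: eval_App; rewrite -!map_comp.
  apply: (@eq_from_nth _ (eval v (node_term n'))); first by rewrite !size_map.
  move=> i; rewrite size_map => lti.
  (* [child] uses the node itself as default of [nth], hence the two defaults. *)
  rewrite (nth_map n') // (nth_map m') -?[size (succ m')]Ldeg //; exact: ch.
have node_of t : t \in subterms e.1 ++ subterms e.2 ->
    exists n : node G, node_term n = t by move=> te; apply/terms; exists e.
have sub_refl (t : term Sg) : t \in subterms t by case: t => l ts; apply: mem_head.
have [|n En] := node_of e.1; first by rewrite mem_cat sub_refl.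
have [|m Em] := node_of e.2; first by rewrite mem_cat sub_refl orbT.
rewrite -En -Em; apply/vG/eqP/classes => R _ R_phi _; apply: R_phi.
by rewrite En Em -surjective_pairing.
Qed.

Variable r : node G -> node G.
Hypotheses (hr : unique_representatives r) (acy : acyclic (representative_edge r)).

Lemma sat_expr : sat v (conjunction phi) <->
  forall n, eval v (expr r (r n)) = eval v (expr r n).
Proof.
rewrite sat_egraph; split=> [vG n|vr].
  have cl_repr m : same_class (r m) m by rewrite (same_class_repr hr) repr_idem.
  suff expr_node m : eval v (expr r m) = eval v (node_term m).
    by rewrite !expr_node; apply: vG.
  (* Along $G_r$ the hypothesis is available at [r c], whose node term has the value of that of [c]
     by [vG]. *)
  move: m; apply: (acyclic_ind (succ := fun n => map r (succ n)) acy) => m IH.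
  rewrite exprE // node_termE; apply: eval_App; rewrite -!map_comp.
  apply/eq_in_map => c mc /=; rewrite IH ?map_f //; exact: vG.
have node_expr m : eval v (node_term m) = eval v (expr r m).
  (* Here [vr] first replaces [r c] by [c], a child in [G]. *)
  move: m; apply: (acyclic_ind (@succ_acyclic _ G)) => m IH.
  rewrite exprE // node_termE; apply: eval_App; rewrite -!map_comp.
  by apply/eq_in_map => c mc /=; rewrite vr IH.
move=> n m rnm; rewrite !node_expr -(vr n) -(vr m).
by case: hr => _ /(_ _ _ rnm) ->.
Qed.
End Models.

Theorem theorem1 (Sg : signature) (phi : seq (equation Sg))
    (hphi : all (@well_sorted_eqn Sg) phi)
    (G : egraph Sg) (hG : is_egraph_of phi G)
    (r : node G -> node G) (hr : unique_representatives r) :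
  (exists2 psi : formula Sg,
     toformula_returns r set0 psi &
     equivalent (ex_closure psi) (ex_closure (conjunction phi))) <->
  admissible r.
Proof.
split=> [[psi [k]]|[_ _ acy]].
  case Els: (toformula_lits r k set0) => [ls|//] _ _; split=> //.
    move=> n m; have := same_class_repr hr n m; rewrite /same_class => E.
    by split=> /eqP; [rewrite E|rewrite -E] => /eqP.
  case=> // n p cyc; case: (toformula_lits_toexpr hr (n := n) Els).
  by apply: toexpr_cycle cyc _; rewrite mem_head.
have [ls Els lsP] := toformula_litsE hr acy.
exists (conjunction ls); first by exists #|node G|; rewrite Els.
move=> M v; rewrite !sat_ex_closure.
suff same w : sat (M := M) w (conjunction ls) <-> sat w (conjunction phi).
  by split=> -[w /same ?]; exists w.
rewrite (sat_expr hG w hr acy) sat_conjunction; split=> [wls n|wr e /lsP[n [_ ->]]].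
  (* Representatives contribute no literal, but their equation is trivial. *)
  have [<-//|nr] := eqVneq n (r n).
  by apply: (wls (_, _)); apply/lsP; exists n.
exact: wr.
Qed.
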